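(* Let $U$ be a compact connected semisimple Lie group, and let $\mathbb{F}_{\Theta_1}=\mathrm{Ad}(U)(iH_1)$ and $\mathbb{F}_{\Theta_2}=\mathrm{Ad}(U)(iH_2)$ be flags, where $H_1,H_2$ lie in the positive Weyl chamber. Then the product of flags $\mathbb{F}_{\Theta_1}\times\mathbb{F}_{\Theta_2}$ admits an isotropic orbit by the diagonal action of $U$ if and only if $\mathbb{F}_{\Theta_2}$ is the dual flag $\mathbb{F}_{\Theta_1^*}$ of $\mathbb{F}_{\Theta_1}$.
   Context: Let $\mathfrak{u}$ be the Lie algebra of $U$, $\langle\cdot,\cdot\rangle$ its Cartan--Killing form, $\mathfrak{t}=i\mathfrak{h}_{\mathbb{R}}$ the Lie algebra of a maximal torus, and fix a positive Weyl chamber in $\mathfrak{h}_{\mathbb{R}}$; every adjoint orbit of $U$ in $\mathfrak{u}$ has the form $\mathrm{Ad}(U)(iH)$ with $H$ in the closure of the positive Weyl chamber. The flags of the complex group $G$ with Lie algebra $\mathfrak{u}_{\mathbb{C}}$ are realized as these adjoint orbits, $\mathbb{F}_\Theta=\mathrm{Ad}(U)(iH)$, where $\Theta$ is the set of simple roots vanishing on $H$. Each adjoint orbit carries the Kirillov--Kostant--Souriau symplectic form $\omega_x([X,x],[Y,x])=\langle x,[X,Y]\rangle$, and the product carries the product symplectic form (the sum of the pullbacks from the factors). The diagonal action is $u\cdot(x,y)=(\mathrm{Ad}(u)x,\mathrm{Ad}(u)y)$. The dual flag of $\mathbb{F}_\Theta=\mathrm{Ad}(U)(iH)$ is $\mathbb{F}_{\Theta^*}=\mathrm{Ad}(U)(-iH)=\mathrm{Ad}(U)(i\sigma(H))$,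 where $\sigma=-w_0$, $w_0$ is the longest element of the Weyl group, and $\Theta^*=\sigma\Theta$; thus $\mathrm{Ad}(U)(iH_1)$ and $\mathrm{Ad}(U)(iH_2)$ are dual precisely when $-iH_1\in\mathrm{Ad}(U)(iH_2)$, equivalently $H_2=\sigma(H_1)$. An orbit is isotropic if the symplectic form vanishes on it. *)

(* Defs.v *)
From HB Require Import structures.
From mathcomp Require Import all_boot all_order all_algebra.
From mathcomp Require Import all_classical all_reals all_analysis.

Set Implicit Arguments.
Unset Strict Implicit.
Unset Printing Implicit Defensive.

Import Order.TTheory GRing.Theory Num.Theory.
Import numFieldNormedType.Exports.

Local Open Scope classical_set_scope.
Local Open Scope ring_scope.

(* C^k regularity of f on an open set A of a finite-dimensional space. Only the
   germs of f at the points of A matter: the values of f outside A are junk. *)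
Fixpoint Ck_on (R : realType) (V W : normedModType R) (k : nat)
    (A : set V) (f : V -> W) : Prop :=
  match k with
  | 0 => forall x, A x -> {for x, continuous f}
  | k'.+1 => (forall x, A x -> differentiable f x) /\
             (forall v, Ck_on k' A (fun x => 'd f x v))
  end.

Definition smooth_on (R : realType) (V W : normedModType R)
    (A : set V) (f : V -> W) : Prop := forall k, Ck_on k A f.

Section Manifolds.
Variable R : realType.

Record chart (E : normedModType R) (M : topologicalType) := Chart {
  cdom : set M;
  cimg : set E;
  cmap : M -> E;
  cinv : E -> M }.

Definition is_chart (E : normedModType R) (M : topologicalType)
    (c : chart E M) : Prop :=
  [/\ open (cdom c), open (cimg c),
      (forall x, cdom c x -> cimg c (cmap c x) /\ cinv c (cmap c x) = x),
      (forall y, cimg c y -> cdom c (cinv c y) /\ cmap c (cinv c y) = y) &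
      (forall x, cdom c x -> {for x, continuous (cmap c)}) /\
      (forall y, cimg c y -> {for y, continuous (cinv c)})].

Definition smooth_map (E F : normedModType R) (M N : topologicalType)
    (A : set (chart E M)) (B : set (chart F N)) (f : M -> N) : Prop :=
  continuous f /\
  forall a b, A a -> B b ->
    smooth_on (cimg a `&` [set y | cdom b (f (cinv a y))])
              (fun y => cmap b (f (cinv a y))).

Definition smooth_atlas (E : normedModType R) (M : topologicalType)
    (A : set (chart E M)) : Prop :=
  [/\ (forall a, A a -> is_chart a),
      (forall x, exists2 a, A a & cdom a x) &
      smooth_map A A idfun].

Definition prod_chart (E F : normedModType R) (M N : topologicalType)
    (a : chart E M) (b : chart F N) : chart (E * F)%type (M * N)%type :=
  Chart (cdom a `*` cdom b) (cimg a `*` cimg b)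
        (fun x => (cmap a x.1, cmap b x.2))
        (fun y => (cinv a y.1, cinv b y.2)).

Definition prod_atlas (E F : normedModType R) (M N : topologicalType)
    (A : set (chart E M)) (B : set (chart F N)) :
    set (chart (E * F)%type (M * N)%type) :=
  [set c | exists a b, [/\ A a, B b & c = prod_chart a b]].

Definition id_chart (E : normedModType R) : chart E E :=
  Chart setT setT idfun idfun.

End Manifolds.

HB.mixin Record isLieGroup (R : realType) (n : nat) U
    of Topological U & Group U := {
  lie_atlas : set (chart 'rV[R]_n U);
  lie_atlas_smooth : smooth_atlas lie_atlas;
  lie_hausdorff : hausdorff_space U;
  lie_second_countable : @second_countable U;
  lie_mul_smooth :
    smooth_map (prod_atlas lie_atlas lie_atlas) lie_atlas
      (fun p : U * U => (p.1 * p.2)%g);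
  lie_inv_smooth : smooth_map lie_atlas lie_atlas (fun x : U => (x^-1)%g)
}.

#[short(type="lieGroupType")]
HB.structure Definition LieGroup (R : realType) (n : nat) :=
  {U of isLieGroup R n U & Topological U & Group U}.

Section LieAlgebra.
Variables (R : realType) (n : nat) (U : lieGroupType R n).

Definition smooth_fun (f : U -> R) : Prop :=
  smooth_map (@lie_atlas R n U) [set id_chart R^o] (f : U -> R^o).

(* Smooth vector fields on U are the derivations D of the algebra of smooth
   functions; D f is junk when f is not smooth. *)
Definition vector_field (D : (U -> R) -> (U -> R)) : Prop :=
  [/\ (forall f, smooth_fun f -> smooth_fun (D f)),
      (forall (a : R) f g, smooth_fun f -> smooth_fun g ->
         D (fun x => a * f x + g x) = (fun x => a * D f x + D g x)) &
      (forall f g, smooth_fun f -> smooth_fun g ->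
         D (fun x => f x * g x) = (fun x => D f x * g x + f x * D g x))].

Definition left_invariant (D : (U -> R) -> (U -> R)) : Prop :=
  forall g f, smooth_fun f ->
    D (fun x => f (g * x)%g) = (fun x => D f (g * x)%g).

(* The vector space u, whose elements X act on functions by the derivations
   d X, is the Lie algebra of U: d is a linear isomorphism from u onto the
   space of left-invariant vector fields. *)
Record lie_algebra_of (u : vectType R) (d : u -> (U -> R) -> (U -> R)) : Prop :=
  LieAlgebraOf {
  lie_field : forall X, vector_field (d X) /\ left_invariant (d X);
  lie_linear : forall (a : R) X Y f, smooth_fun f ->
    d (a *: X + Y) f = (fun x => a * d X f x + d Y f x);
  lie_inj : forall X Y, (forall f, smooth_fun f -> d X f = d Y f) -> X = Y;
  lie_surj : forall D, vector_field D -> left_invariant D ->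
    exists X, forall f, smooth_fun f -> d X f = D f
}.

Variables (u : vectType R) (d : u -> (U -> R) -> (U -> R)).

(* [X, Y]: the element of u acting as the commutator of vector fields. *)
Definition lie_br (X Y : u) : u :=
  xget 0 [set Z | forall f, smooth_fun f ->
    d Z f = (fun x => d X (d Y f) x - d Y (d X f) x)].

(* Ad(g) X: the push-forward of the field X by h |-> g h g^-1. *)
Definition Ad (g : U) (X : u) : u :=
  xget 0 [set Y | forall f, smooth_fun f ->
    d Y f = (fun h => d X (fun k => f (g * k * g^-1)%g) (g^-1 * h * g)%g)].

(* The trace of ad X \o ad Y. *)
Definition killing (X Y : u) : R :=
  \sum_(i < \dim {:u})
    coord (vbasis {:u}) i (lie_br X (lie_br Y (vbasis {:u})`_i)).

Definition is_ideal (I : {vspace u}) : Prop :=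
  forall X Y, Y \in I -> lie_br X Y \in I.

Definition derived (I : {vspace u}) : {vspace u} :=
  (<<[seq lie_br X Y | X <- vbasis I, Y <- vbasis I]>>)%VS.

Definition is_solvable (I : {vspace u}) : Prop :=
  exists k, iter k derived I = 0%VS.

Definition is_semisimple : Prop :=
  forall I : {vspace u}, is_ideal I -> is_solvable I -> I = 0%VS.

Definition is_torus (T : set U) : Prop :=
  [/\ T 1%g,
      (forall x y, T x -> T y -> T (x * y^-1)%g),
      (forall x y, T x -> T y -> (x * y = y * x)%g),
      compact T & connected T].

Definition is_maximal_torus (T : set U) : Prop :=
  is_torus T /\ forall T', is_torus T' -> T `<=` T' -> T' = T.

Definition one_parameter_subgroup (X : u) (c : R -> U) : Prop :=
  [/\ continuous c,
      (forall s t, c (s + t) = (c s * c t)%g) &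
      forall f, smooth_fun f ->
        is_derive (0 : R) (1 : R) (fun t => f (c t)) (d X f 1%g)].

Definition lie_of_subgroup (T : set U) : set u :=
  [set X | exists2 c, one_parameter_subgroup X c & forall t, T (c t)].

(* The pair (X, Y) : u * u stands for X + iY in the complexification of u. *)
Definition cplx_i (Z : u * u) : u * u := (- Z.2, Z.1).

Definition cplx_br (Z W : u * u) : u * u :=
  (lie_br Z.1 W.1 - lie_br Z.2 W.2, lie_br Z.1 W.2 + lie_br Z.2 W.1).

(* The real space h_R such that t = i h_R. *)
Definition hR (t : set u) : set (u * u) :=
  [set H | t (cplx_i H).1 /\ (cplx_i H).2 = 0].

(* A root is real-valued on h_R; only its values there are meaningful. *)
Definition is_root (t : set u) (alpha : u * u -> R) : Prop :=
  (exists2 H, hR t H & alpha H != 0) /\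
  (exists2 E, E != 0 & forall H, hR t H -> cplx_br H E = alpha H *: E).

(* The Weyl chamber containing a regular element H0. *)
Definition is_weyl_chamber (t : set u) (C : set (u * u)) : Prop :=
  exists H0, [/\ hR t H0,
    (forall alpha, is_root t alpha -> alpha H0 != 0) &
    C = [set H | hR t H /\
          forall alpha, is_root t alpha -> 0 < alpha H0 -> 0 < alpha H]].

Definition weyl_chamber_closure (t : set u) (C : set (u * u)) : set (u * u) :=
  [set H | hR t H /\ forall alpha, is_root t alpha ->
     (forall H', C H' -> 0 < alpha H') -> 0 <= alpha H].

Definition Ad_orbit (X : u) : set u := [set Ad g X | g in [set: U]].

(* F_Theta = Ad(U)(iH), for H in h_R (so that iH lies in u). *)
Definition flag (H : u * u) : set u := Ad_orbit (cplx_i H).1.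

(* F_{Theta^*} = Ad(U)(-iH). *)
Definition dual_flag (H : u * u) : set u := Ad_orbit (- (cplx_i H).1).

(* The Kirillov-Kostant-Souriau form on the tangent space {[X, x]} of the
   adjoint orbit of x: omega_x([X, x], [Y, x]) = <x, [X, Y]>. The value does not
   depend on the choice of X and Y. *)
Definition kks (x v w : u) : R :=
  let X := xget 0 [set X | lie_br X x = v] in
  let Y := xget 0 [set Y | lie_br Y x = w] in
  killing x (lie_br X Y).

Definition prod_kks (p v w : u * u) : R :=
  kks p.1 v.1 w.1 + kks p.2 v.2 w.2.

Definition diag_orbit (p : u * u) : set (u * u) :=
  [set (Ad g p.1, Ad g p.2) | g in [set: U]].

(* The tangent space at q of the orbit of q under the diagonal action. *)
Definition diag_orbit_tangent (q : u * u) : set (u * u) :=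
  [set (lie_br X q.1, lie_br X q.2) | X in [set: u]].

Definition isotropic_orbit (p : u * u) : Prop :=
  forall q, diag_orbit p q ->
    forall v w, diag_orbit_tangent q v -> diag_orbit_tangent q w ->
      prod_kks q v w = 0.

End LieAlgebra.

(* Main.v *)
From HB Require Import structures.
Require Import Defs.
From mathcomp Require Import all_boot all_order all_algebra.
From mathcomp Require Import all_classical all_reals all_analysis.
From mathcomp Require Import ring complex.

Set Implicit Arguments.
Unset Strict Implicit.
Unset Printing Implicit Defensive.

Import Order.TTheory GRing.Theory Num.Theory.
Import numFieldNormedType.Exports.

Local Open Scope ring_scope.

(** Let p = (x, y) and write [,] for the Killing form.  The tangent vectors to
    the diagonal orbit at p are ([X, x], [X, y]), and the product symplectic form
    takes the value <x, [X, Y]> + <y, [X, Y]> = <x + y, [X, Y]> on the two vectors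
    given by X and Y.  By invariance this is <[x + y, X], Y>, so if the Killing
    form is nondegenerate an isotropic orbit forces x + y to be central, hence
    x + y = 0, and conversely every orbit through (x, -x) is isotropic because
    Ad(g) is linear.  Since Ad is an action by linear maps, an x in Ad(U)(iH1)
    with -x in Ad(U)(iH2) exists exactly when Ad(U)(iH2) = Ad(U)(-iH1).

    Two things have to be supplied.  First, that the bracket and Ad, which are
    defined by choice among left-invariant derivations of the smooth functions,
    have their defining properties ([lie_brP], [AdP]): one shows that the
    commutator and the push-forward are again left-invariant vector fields, which
    rests on the stability of smooth functions under products and translations,
    that is, on the chain rule in charts ([Ck_comp], [smooth_fun_comp]).

    Second, that the Killing form of a semisimple algebra is nondegenerate
    ([killing_form_nondegenerate]).  The proof is Cartan's argument arranged
    around derivations.  Let K be the radical of the form and x in I = [K, u].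
    Then tr(ad x D) = 0 for every derivation D ([trace_ad_derivation]).  Over the
    complex numbers the operator D that multiplies the generalised eigenspace of
    ad x of eigenvalue a by the conjugate of a is a derivation, because
    conjugation is additive and the product of the eigenspaces for a and b lies in
    the one for a + b; the trace is then the sum of the |a|^2, so ad x has only
    the eigenvalue 0 ([closed_nilpotent_derivation]).  Thus I consists of
    ad-nilpotent elements, and Engel's theorem gives I a nonzero centre unless
    I = 0.  This centre is an abelian ideal, so I = 0; then K is central, itself
    an abelian ideal, and K = 0. *)

(** * Derivations over an algebraically closed field *)

(** A bilinear product on row vectors is encoded by its multiplication operators:
    the product of v and w is [w *m M v].  The Leibniz rule for D, read as an
    identity between operators in w, is then a commutator formula. *)
Definition mx_derivation (F : pzRingType) (m : nat)
    (M : 'rV[F]_m -> 'M[F]_m) (D : 'M[F]_m) : Prop :=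
  forall v, M (v *m D) = M v *m D - D *m M v.

Section ClosedDerivation.
Variable F : numClosedFieldType.

Lemma coprimep_prod_XsubC_exp (s : seq F) (a : F) (k : nat) : a \notin s ->
  coprimep (\prod_(b <- s) ('X - b%:P) ^+ k) (('X - a%:P) ^+ k).
Proof.
elim: s => [|b s IHs]; first by rewrite big_nil coprime1p.
rewrite in_cons negb_or => /andP[ab as_].
rewrite big_cons coprimepMl IHs // andbT coprimep_expl // coprimep_expr //.
by rewrite coprimep_XsubC2 // subr_eq0.
Qed.

(** Chinese remaindering, one modulus at a time: a Bezout relation corrects the
    interpolant at the new node by a multiple of the old moduli. *)
Lemma polynomial_interpolation_mod (s : seq F) (f : F -> F) (k : nat) : uniq s ->
  exists p : {poly F}, forall a, a \in s -> ('X - a%:P) ^+ k %| p - (f a)%:P.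
Proof.
elim: s => [|b s IHs]; first by exists 0.
move=> /= /andP[bs /IHs[p pP]].
pose q := \prod_(a <- s) ('X - a%:P) ^+ k.
have cop : coprimep q (('X - b%:P) ^+ k) by exact: coprimep_prod_XsubC_exp.
have /Bezout_eq1_coprimepP [[u v] /= uvE] := cop.
exists (p + ((f b)%:P - p) * (u * q)) => a; rewrite in_cons => /orP[/eqP->|aS].
  have -> : u * q = 1 - v * ('X - b%:P) ^+ k by rewrite -uvE addrK.
  rewrite mulrBr mulr1 addrA [X in X - _ - _]addrC subrK addrAC subrr add0r.
  by rewrite dvdpNr mulrA dvdp_mulIr.
rewrite addrAC dvdp_add ?pP // dvdp_mull // dvdp_mull //.
rewrite /q; elim: (s) aS => // c r IHr; rewrite in_cons big_cons.
by case/orP=> [/eqP->|/IHr]; [exact: dvdp_mulIl|exact: dvdp_mull].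
Qed.

Variable m : nat.
Implicit Types (A D : 'M[F]_m.+1) (v w : 'rV[F]_m.+1).

Lemma horner_mx_generalized_eigenvector A (p : {poly F}) a c k v :
  ('X - a%:P) ^+ k %| p - c%:P -> v *m (A - a%:M) ^+ k = 0 ->
  v *m horner_mx A p = c *: v.
Proof.
case/dvdpP=> q /eqP; rewrite subr_eq addrC => /eqP-> vA.
rewrite rmorphD /= horner_mx_C mulmxDr mul_mx_scalar mulrC rmorphM rmorphXn /=.
by rewrite rmorphB /= horner_mx_X horner_mx_C -mulmxE mulmxA vA mul0mx addr0.
Qed.

Lemma char_poly_split A : {s : seq F | char_poly A = \prod_(a <- s) ('X - a%:P)}.
Proof.
have [s sP] := closed_field_poly_normal (char_poly A).
by exists s; rewrite sP (monicP (char_poly_monic A)) scale1r.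
Qed.

(** If [q - mu] had no common root with the characteristic polynomial, a Bezout
    relation and Cayley-Hamilton would make [q(A) - mu] invertible. *)
Lemma root_char_poly_horner A (q : {poly F}) mu :
  root (char_poly (horner_mx A q)) mu ->
  exists2 a, root (char_poly A) a & q.[a] = mu.
Proof.
rewrite -eigenvalue_root_char => /eigenvalueP[v vq v0].
case: (boolP (coprimep (char_poly A) (q - mu%:P))) => [cop|].
  have /Bezout_eq1_coprimepP [[a b] /= abE] := cop.
  case/eqP: v0; have -> : v = v *m horner_mx A 1 by rewrite rmorph1 mulmx1.
  rewrite -abE.
  rewrite rmorphD /= [b * _]mulrC !rmorphM /= Cayley_Hamilton mulr0 add0r.
  by rewrite -mulmxE mulmxA rmorphB /= horner_mx_C mulmxBr vq mul_mx_scalar subrr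
     mul0mx.
rewrite /coprimep => /closed_rootP[a].
rewrite root_gcd => /andP[ra /rootP]; rewrite hornerD hornerN hornerC => /eqP.
by rewrite subr_eq0 => /eqP; exists a.
Qed.

Lemma nilpotent_of_zero_eigenvalues A :
  (forall a, root (char_poly A) a -> a = 0) -> A ^+ m.+1 = 0.
Proof.
have [s sP] := char_poly_split A => H0.
have s0 : char_poly A = 'X ^+ m.+1.
  have ssz : size s = m.+1.
    by have := size_char_poly A; rewrite sP size_prod_XsubC => -[].
  rewrite sP -ssz big_seq (eq_bigr (fun _ => 'X)); last first.
    by move=> a aS; rewrite (H0 a) ?subr0 // sP root_prod_XsubC.
  by rewrite -big_seq big_const_seq count_predT iter_mulr_1.
have := Cayley_Hamilton A; rewrite s0 rmorphXn /= horner_mx_X //.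
Qed.

Lemma mxtrace_sum_roots A s : char_poly A = \prod_(a <- s) ('X - a%:P) ->
  \tr A = \sum_(a <- s) a.
Proof.
move=> sP; have := char_poly_trace A (ltn0Sn m); rewrite sP.
have ssz : size s = m.+1.
  by have := size_char_poly A; rewrite sP size_prod_XsubC => -[].
have -> : m.+1.-1 = (size s).-1 by rewrite ssz.
by rewrite coefPn_prod_XsubC ?ssz // => /oppr_inj->.
Qed.

(** The space is the sum of the generalised eigenspaces of A, so an additive
    property may be checked on generalised eigenvectors. *)
Lemma generalized_eigenvector_ind A (P : 'rV[F]_m.+1 -> Prop) :
  P 0 -> (forall v w, P v -> P w -> P (v + w)) ->
  (forall a v, root (char_poly A) a -> v *m (A - a%:M) ^+ m.+1 = 0 -> P v) ->
  forall v, P v.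
Proof.
move=> P0 PD Pa v.
have [s sP] := char_poly_split A.
suff H t k: uniq t -> {subset t <= s} ->
   forall v, v *m horner_mx A (\prod_(a <- t) ('X - a%:P) ^+ k) = 0 ->
   (forall a v, a \in s -> v *m (A - a%:M) ^+ k = 0 -> P v) -> P v.
  apply: (H (undup s) m.+1); rewrite ?undup_uniq //.
  - by move=> a; rewrite mem_undup.
  - suff /dvdpP[q ->] : char_poly A %| \prod_(a <- undup s) ('X - a%:P) ^+ m.+1.
      by rewrite rmorphM /= Cayley_Hamilton mulr0 mulmx0.
    have ssz : (size s <= m.+1)%N.
      by have := size_char_poly A; rewrite sP size_prod_XsubC => -[->].
    rewrite sP -prodr_undup_exp_count.
    apply: (big_ind2 (fun x y => x %| y)) => //.
      by move=> *; apply: dvdp_mul.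
    move=> a _; rewrite dvdp_exp2l //.
    by apply: leq_trans ssz; apply: count_size.
  - by move=> a w aS; apply: Pa; rewrite sP root_prod_XsubC.
elim: t => [|a t IHt] /=.
  by move=> _ _ w; rewrite big_nil rmorph1 mulmx1 => -> _.
move=> /andP[at_ ut] ts w; rewrite big_cons => wE PaS.
have cop : coprimep (('X - a%:P) ^+ k) (\prod_(a <- t) ('X - a%:P) ^+ k).
  by rewrite coprimep_sym coprimep_prod_XsubC_exp.
have : (w <= kermxpoly A (('X - a%:P) ^+ k * \prod_(a <- t) ('X - a%:P) ^+ k))%MS.
  by apply/sub_kermxP.
rewrite (kermxpolyM _ cop) => /sub_addsmxP[[u1 u2] /= ->]; apply: PD.
  apply: (PaS a); first by rewrite ts // mem_head.
  rewrite -mulmxA.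
  suff -> : kermxpoly A (('X - a%:P) ^+ k) *m (A - a%:M) ^+ k = 0 by rewrite mulmx0.
  apply/sub_kermxP; rewrite /kermxpoly rmorphXn rmorphB /= horner_mx_X horner_mx_C.
  exact: submx_refl.
apply: IHt => //; first by move=> b bt; rewrite ts // in_cons bt orbT.
by rewrite -mulmxA mulmx_ker mulmx0.
Qed.

Variable M : {linear 'rV[F]_m.+1 -> 'M[F]_m.+1}.

(** Applying [A - (a + b)] to a product distributes, by the Leibniz rule, into
    [A - a] applied to one factor plus [A - b] applied to the other; after
    [i + j] steps every term has lost one of its factors. *)
Lemma generalized_eigenvector_mul A i j v w a b : mx_derivation M A ->
  v *m (A - a%:M) ^+ i = 0 -> w *m (A - b%:M) ^+ j = 0 ->
  w *m M v *m (A - (a + b)%:M) ^+ (i + j) = 0.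
Proof.
move=> derA; move: {2}(i + j)%N (leqnn (i + j)) => k.
elim: k i j v w => [|k IHk] [|i] [|j] v w //.
all: try by move=> _; rewrite expr0 mulmx1 => ->; rewrite linear0 mulmx0 mul0mx.
all: try by move=> _ _; rewrite expr0 mulmx1 => ->; rewrite !mul0mx.
rewrite addSn ltnS addnS => ijk vi wj.
have step : w *m M v *m (A - (a + b)%:M) =
    w *m M (v *m (A - a%:M)) + w *m (A - b%:M) *m M v.
  rewrite [(a + b)%:M]raddfD /= [v *m _]mulmxBr [w *m (A - _)]mulmxBr (linearB M) /=.
  rewrite derA !mul_mx_scalar (linearZ_LR M) /= !mulmxBr mulmxDr mulmxBl !mul_mx_scalar.
  rewrite -scalemxAl -scalemxAr !mulmxA opprD.
  have key (x y z t : 'rV[F]_m.+1) : x + (- z - t) = x - y - z + (y - t).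
    by rewrite [x - y - z]addrAC addrA [RHS]addrA subrK.
  exact: key.
rewrite exprS -mulmxE mulmxA step mulmxDl.
rewrite -{1}addnS IHk ?addnS // -1?addSn; last by rewrite -mulmxA mulmxE -exprS.
by rewrite IHk ?addSn ?addr0 // -mulmxA mulmxE -exprS.
Qed.

(** The hypothesis is used for the single polynomial p with p(A) equal to the
    conjugate of a on the generalised eigenspace of A for a.  The eigenvalues of
    A p(A) are then the |a|^2, which are nonnegative with sum 0. *)
Lemma closed_nilpotent_derivation A : mx_derivation M A ->
  (forall p, mx_derivation M (horner_mx A p) -> \tr (A *m horner_mx A p) = 0) ->
  A ^+ m.+1 = 0.
Proof.
move=> derA trA.
have [s sP] := char_poly_split A.
have rs a : root (char_poly A) a = (a \in s) by rewrite sP root_prod_XsubC.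
(* Products of generalised eigenvectors, which are killed by powers up to
   [m.+1 + m.+1], must be covered as well, hence the exponent and the sums of
   eigenvalues among the nodes; a sum that is not an eigenvalue is harmless. *)
pose n := (m.+1 + m.+1)%N.
have [p pP] := polynomial_interpolation_mod (fun a => a^*) n
  (undup_uniq (s ++ [seq a + b | a <- s, b <- s])).
have pA a k v : (k <= n)%N -> a \in s ++ [seq a + b | a <- s, b <- s] ->
    v *m (A - a%:M) ^+ k = 0 -> v *m horner_mx A p = a^* *: v.
  move=> kn aS vk; apply: (@horner_mx_generalized_eigenvector _ _ _ _ n).
    by apply: pP; rewrite mem_undup.
  by rewrite -(subnKC kn) exprD -mulmxE mulmxA vk mul0mx.
have derD : mx_derivation M (horner_mx A p).
  move=> v; apply/row_matrixP => i; rewrite !rowE.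
  move: (delta_mx 0 i) => w; rewrite mulmxBr !mulmxA.
  elim/(generalized_eigenvector_ind (A := A)): v => [|v1 v2 H1 H2|a v ra va].
  - by rewrite mul0mx !(linear0 M) !mulmx0 mul0mx subr0.
  - rewrite mulmxDl !(linearD M) /= !mulmxDr mulmxDl H1 H2.
    by rewrite opprD addrACA.
  elim/(generalized_eigenvector_ind (A := A)): w => [|w1 w2 H1 H2|b w rb wb].
  - by rewrite !mul0mx subr0.
  - by rewrite !mulmxDl H1 H2 opprD addrACA.
  rewrite rs in ra; rewrite rs in rb.
  rewrite (pA a m.+1 v) ?leq_addr ?mem_cat ?ra // (pA b m.+1 w) ?leq_addr ?mem_cat ?rb //.
  have abS : a + b \in s ++ [seq x + y | x <- s, y <- s].
    by rewrite mem_cat allpairs_f ?orbT.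
  rewrite (pA (a + b) n _ (leqnn n) abS (generalized_eigenvector_mul derA va wb)).
  rewrite (linearZ_LR M) /= -scalemxAl -scalemxAr -scalerBl rmorphD /=.
  by rewrite addrK.
have pE a : a \in s -> p.[a] = a^*.
  move=> aS; have : 'X - a%:P %| p - (a^*)%:P.
    by apply: dvdp_trans (pP a _); rewrite ?mem_undup ?mem_cat ?aS // dvdp_exp.
  rewrite -root_factor_theorem => /rootP; rewrite hornerD hornerN hornerC => /eqP.
  by rewrite subr_eq0 => /eqP.
have [t tP] := char_poly_split (horner_mx A ('X * p)).
have rt c : c \in t -> exists2 a, a \in s & a * a^* = c.
  rewrite -root_prod_XsubC -tP => /root_char_poly_horner[a]; rewrite rs => aS <-.
  by exists a => //; rewrite hornerM hornerX pE.
have : \sum_(c <- t) c = 0.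
  by rewrite -(mxtrace_sum_roots tP) rmorphM /= horner_mx_X -mulmxE trA.
move/eqP; rewrite big_seq psumr_eq0 => [/allP t0|c /rt[a _ <-]]; last first.
  exact: mul_conjC_ge0.
have nil : horner_mx A ('X * p) ^+ m.+1 = 0.
  apply: nilpotent_of_zero_eigenvalues => c; rewrite tP root_prod_XsubC => ct.
  by have := t0 _ ct; rewrite ct => /eqP.
apply: nilpotent_of_zero_eigenvalues => a ra.
have /eigenvalueP[v va v0] : eigenvalue A a by rewrite eigenvalue_root_char.
rewrite rs in ra.
have vq : v *m horner_mx A ('X * p) = (a * a^*) *: v.
  rewrite rmorphM /= horner_mx_X -mulmxE mulmxA va -scalemxAl (pA a 1%N) //.
  - by rewrite scalerA.
  - by rewrite mem_cat ra.
  - by rewrite expr1 mulmxBr va mul_mx_scalar subrr.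
have vqk k : v *m horner_mx A ('X * p) ^+ k = (a * a^*) ^+ k *: v.
  elim: k => [|k IHk]; first by rewrite !expr0 mulmx1 scale1r.
  by rewrite exprSr -mulmxE mulmxA IHk -scalemxAl vq scalerA exprSr.
have := vqk m.+1; rewrite nil mulmx0 => /esym/eqP.
rewrite scaler_eq0 (negPf v0) orbF expf_eq0 /= mulf_eq0 conjC_eq0 orbb.
by move/eqP.
Qed.
End ClosedDerivation.

(** * Descent to a real closed field *)

Section RealDerivation.
Variables (R : rcfType) (m : nat).
Variable M : {linear 'rV[R]_m.+1 -> 'M[R]_m.+1}.
Let c := (real_complex R : {rmorphism R -> R[i]}).

(** The complexification of the product encoded by M, given by its values on the
    standard basis. *)
Definition cplx_prod (z : 'rV[R[i]]_m.+1) : 'M[R[i]]_m.+1 :=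
  \sum_i z 0 i *: map_mx c (M (delta_mx 0 i)).

Lemma cplx_prod_linear : linear cplx_prod.
Proof.
move=> a v w; rewrite /cplx_prod scaler_sumr -big_split /=.
by apply: eq_bigr => i _; rewrite !mxE scalerDl scalerA.
Qed.
HB.instance Definition _ := GRing.isLinear.Build _ _ _ _ _ cplx_prod_linear.

Lemma cplx_prod_real v : cplx_prod (map_mx c v) = map_mx c (M v).
Proof.
rewrite {2}[v]row_sum_delta linear_sum map_mx_sum; apply: eq_bigr => i _.
by rewrite linearZ /= map_mxZ mxE.
Qed.

Lemma cplx_parts p q (X : 'M[R[i]]_(p, q)) :
  X = map_mx c (map_mx (@complex.Re R) X) + 'i%C *: map_mx c (map_mx (@complex.Im R) X).
Proof.
by apply/matrixP=> i j; rewrite !mxE; case: (X i j) => a b; simpc.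
Qed.

Lemma cplx_parts_inj p q (X Y X' Y' : 'M[R]_(p, q)) :
  map_mx c X + 'i%C *: map_mx c Y = map_mx c X' + 'i%C *: map_mx c Y' ->
  X = X' /\ Y = Y'.
Proof.
move=> /matrixP H; split; apply/matrixP => i j; have := H i j; rewrite !mxE;
  by simpc => -[].
Qed.

(** A derivation of the complexified product has real and imaginary parts that
    are derivations of the real one, so the trace condition passes to the
    complexification. *)
Lemma nilpotent_derivation A : mx_derivation M A ->
  (forall D, mx_derivation M D -> \tr (A *m D) = 0) -> A ^+ m.+1 = 0.
Proof.
move=> derA trA; apply/eqP; rewrite -(map_mx_eq0 c) rmorphXn /=; apply/eqP.
apply: (closed_nilpotent_derivation (M := cplx_prod)).
  move=> z; rewrite [z]row_sum_delta mulmx_suml !(linear_sum cplx_prod) /= mulmx_suml mulmx_sumr -sumrB.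
  apply: eq_bigr => i _; rewrite -scalemxAl !(linearZ_LR cplx_prod) /= -scalemxAl -scalemxAr.
  rewrite -scalerBr; congr (_ *: _).
  have -> : delta_mx 0 i = map_mx c (delta_mx 0 i) :> 'rV_m.+1 by rewrite map_delta_mx.
  by rewrite -map_mxM !cplx_prod_real derA map_mxB !map_mxM.
move=> p; move: (horner_mx _ p) => D derD.
have D12 (v : 'rV[R]_m.+1) :
    M (v *m map_mx (@complex.Re R) D) =
      M v *m map_mx (@complex.Re R) D - map_mx (@complex.Re R) D *m M v /\
    M (v *m map_mx (@complex.Im R) D) =
      M v *m map_mx (@complex.Im R) D - map_mx (@complex.Im R) D *m M v.
  apply: cplx_parts_inj; have := derD (map_mx c v).
  rewrite [in X in X -> _](cplx_parts D) mulmxDr -scalemxAr -!map_mxM.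
  rewrite (linearD cplx_prod) (linearZ_LR cplx_prod) /= !cplx_prod_real => ->.
  rewrite mulmxDr mulmxDl -scalemxAr -scalemxAl -!map_mxM !map_mxB scalerBr opprD.
  by rewrite addrACA.
rewrite (cplx_parts D) mulmxDr -scalemxAr -!map_mxM mxtraceD mxtraceZ.
rewrite !trace_map_mx !trA ?rmorph0 ?mulr0 ?addr0 // => v.
- by case: (D12 v).
- by case: (D12 v).
Qed.
End RealDerivation.

(** The same in arbitrary dimension, with nilpotency expressed by iteration so as
    to apply to brackets. *)
Lemma nilpotent_derivation_iter (R : rcfType) n (M : {linear 'rV[R]_n -> 'M[R]_n})
    (A : 'M[R]_n) : mx_derivation M A ->
  (forall D, mx_derivation M D -> \tr (A *m D) = 0) ->
  exists k, forall v : 'rV[R]_n, iter k (mulmxr A) v = 0.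
Proof.
case: n => [|m] in M A * => dA tA.
  by exists 0%N => v; rewrite thinmx0.
exists m.+1 => v.
suff -> k : iter k (mulmxr A) v = v *m A ^+ k.
  by rewrite (nilpotent_derivation dA tA) mulmx0.
elim: k => [|k IHk]; first by rewrite expr0 mulmx1.
by rewrite iterS IHk exprSr -mulmxE mulmxA.
Qed.

(** * Engel's theorem and the Killing form *)

Definition linear_pred (K : fieldType) (V : vectType K) (P : V -> Prop) : Prop :=
  P 0 /\ forall a x y, P x -> P y -> P (a *: x + y).

(** A subspace of maximal dimension among those contained in P is all of P, since
    any further vector of P could be added to it. *)
Lemma linear_pred_vspace (K : fieldType) (V : vectType K) (P : V -> Prop) :
  linear_pred P -> exists W : {vspace V}, forall x, x \in W <-> P x.
Proof.
move=> [P0 PD].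
pose Q k := `[< exists2 W : {vspace V}, \dim W = k & forall x, x \in W -> P x >].
have exQ : exists k, Q k.
  exists 0%N; apply/asboolP; exists 0%VS; first exact: dimv0.
  by move=> x; rewrite memv0 => /eqP->.
have bQ k : Q k -> (k <= \dim {:V})%N.
  by move/asboolP=> [W <- _]; rewrite dimvS ?subvf.
case: (ex_maxnP exQ bQ) => k /asboolP[W dW WP] maxk.
exists W => x; split=> [/WP//|Px].
have /maxk : Q (\dim (W + <[x]>)).
  apply/asboolP; exists (W + <[x]>)%VS => // _ /memv_addP[y yW [_ /vlineP[a ->] ->]].
  by rewrite addrC; apply: PD => //; apply: WP.
rewrite -dW => le; have /eqP -> : W == (W + <[x]>)%VS by rewrite eqEdim addvSl.
by apply: (subvP (addvSr W <[x]>)); apply: memv_line.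
Qed.

Section LieAlgebra.
Variables (R : rcfType) (u : vectType R).

Record lie_bracket (br : u -> u -> u) : Prop := LieBracket {
  br_linearl : forall a X Y Z, br (a *: X + Y) Z = a *: br X Z + br Y Z;
  br_anti : forall X Y, br X Y = - br Y X;
  br_jacobi : forall X Y Z, br X (br Y Z) = br (br X Y) Z + br Y (br X Z)
}.

Definition killing_form (br : u -> u -> u) (X Y : u) : R :=
  \sum_(i < \dim {:u}) coord (vbasis {:u}) i (br X (br Y (vbasis {:u})`_i)).

Variables (br : u -> u -> u) (L : lie_bracket br).

(** [br X] with the bracket axioms as an argument, so that linearity in the
    second variable can be inferred as a canonical instance. *)
Definition ad_op (_ : lie_bracket br) (X : u) : u -> u := br X.

Lemma ad_op_linear X : linear (ad_op L X).
Proof.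
move=> a Y Z; rewrite /ad_op (br_anti L) (br_linearl L) opprD -scalerN.
by rewrite -!(br_anti L).
Qed.
HB.instance Definition _ X := GRing.isLinear.Build _ _ _ _ (ad_op L X) (@ad_op_linear X).

Lemma br_linearr a X Y Z : br Z (a *: X + Y) = a *: br Z X + br Z Y.
Proof. exact: ad_op_linear. Qed.
Lemma br0r X : br X 0 = 0. Proof. exact: (linear0 (ad_op L X)). Qed.
Lemma br0l X : br 0 X = 0. Proof. by rewrite (br_anti L) br0r oppr0. Qed.

Definition stable_pred (S : {vspace u}) (P : u -> Prop) : Prop :=
  forall X w, X \in S -> P w -> P (br X w).

(** The conclusion of Engel's theorem for every subquotient of the adjoint
    module: it is this relative form, with W' in place of 0, that can be applied
    to a subalgebra acting on a larger one modulo itself. *)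
Definition engel_prop (S : {vspace u}) : Prop :=
  forall W W' : u -> Prop, linear_pred W' -> stable_pred S W -> stable_pred S W' ->
    (exists w, W w /\ ~ W' w) ->
    exists w, [/\ W w, ~ W' w & forall X, X \in S -> W' (br X w)].

(** The vectors of W sent into W' by S are stable under v, since v normalises S;
    the last iterate of v on such a vector that stays outside W' is sent into W'
    by both S and v. *)
Lemma engel_step (S : {vspace u}) v : engel_prop S ->
  (forall X, X \in S -> br X v \in S) ->
  (exists k, forall w, iter k (br v) w = 0) ->
  engel_prop (S + <[v]>)%VS.
Proof.
move=> engS Sv [n nil] W W' [W'0 W'D] stW stW' exW.
have SW X : X \in S -> X \in (S + <[v]>)%VS by apply/subvP/addvSl.
have vS : v \in (S + <[v]>)%VS by apply: (subvP (addvSr S <[v]>)); apply: memv_line.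
have [w [Ww W'w Sw]] : exists w, [/\ W w, ~ W' w & forall X, X \in S -> W' (br X w)].
  by apply: engS => // [X w XS|X w XS]; [apply: stW|apply: stW']; apply: SW.
pose W1 x := W x /\ forall X, X \in S -> W' (br X x).
have W1v k : W1 (iter k (br v) w).
  elim: k => [|k [IW IS]]; first by split.
  split=> [|X XS] /=; first exact: stW.
  rewrite (br_jacobi L) -[br (br X v) _]scale1r; apply: W'D; first by apply: IS; apply: Sv.
  by apply: stW' => //; apply: IS.
have [k []] : exists k, ~ W' (iter k (br v) w) /\ W' (iter k.+1 (br v) w).
  apply: contrapT => no; suff : ~ W' (iter n (br v) w) by rewrite nil.
  elim: (n) => // k IHk Wk; apply: no; exists k; split=> //.
rewrite iterS; case: (W1v k); move: (iter k (br v) w) => x Wx Sx W'x vx.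
exists x; split=> // _ /memv_addP[y yS [_ /vlineP[a ->] ->]].
by rewrite addrC (br_linearl L); apply: W'D => //; apply: Sx.
Qed.

(** A proper subalgebra M of S with the property grows: the property applied to S
    modulo M yields v outside M that normalises M, and [engel_step] passes to
    M + <v>.  Starting from 0 one reaches S. *)
Theorem engel (S : {vspace u}) :
  (forall X Y, X \in S -> Y \in S -> br X Y \in S) ->
  (forall X, X \in S -> exists k, forall w, iter k (br X) w = 0) ->
  engel_prop S.
Proof.
move=> subS nilS.
suff H j : (j <= \dim S)%N -> exists M : {vspace u},
    [/\ (M <= S)%VS, (j <= \dim M)%N, engel_prop M &
        forall X Y, X \in M -> Y \in M -> br X Y \in M].
  have [M [MS dM eM _]] := H _ (leqnn _).
  by have /eqP <- : M == S by rewrite eqEdim MS.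
elim: j => [|j IHj] jS.
  exists 0%VS; split; rewrite ?sub0v //.
    move=> W W' [W'0 _] _ _ [w [Ww W'w]]; exists w; split=> // X.
    by rewrite memv0 => /eqP->; rewrite br0l.
  by move=> X Y; rewrite !memv0 => /eqP-> /eqP->; rewrite br0l.
have [M [MS jM eM subM]] := IHj (ltnW jS).
have [SM|/subvPn[w0 w0S w0M]] := boolP (S <= M)%VS.
  by exists M; split=> //; apply: leq_trans jS (dimvS SM).
have [v [vS vM Mv]] : exists v, [/\ v \in S, ~ (v \in M) &
    forall X, X \in M -> br X v \in M].
  apply: (eM (fun v => v \in S) (fun v => v \in M)).
  - by split=> [|a x y xM yM]; rewrite ?mem0v // memvD ?memvZ.
  - by move=> X w XM; apply: subS; apply: (subvP MS).
  - by move=> X w; apply: subM.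
  - by exists w0; split=> //; apply/negP.
exists (M + <[v]>)%VS; split.
- by rewrite subv_add MS -memvE.
- apply: leq_ltn_trans jM _; rewrite ltn_neqAle dimvS ?addvSl // andbT.
  apply/negP => /eqP dE; apply: vM.
  have /eqP -> : M == (M + <[v]>)%VS by rewrite eqEdim addvSl /= dE.
  by apply: (subvP (addvSr M <[v]>)); apply: memv_line.
- by apply: engel_step => //; apply: nilS.
- move=> _ _ /memv_addP[x xM [_ /vlineP[a ->] ->]] /memv_addP[y yM [_ /vlineP[b ->] ->]].
  have vv : br v v = 0.
    have /eqP := br_anti L v v; rewrite -addr_eq0 -mulr2n -scaler_nat scaler_eq0.
    by rewrite pnatr_eq0 => /eqP.
  apply: (subvP (addvSl M <[v]>)).
  rewrite [x + _]addrC [y + _]addrC (br_linearl L) !br_linearr vv scaler0 add0r.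
  by rewrite [br v y](br_anti L) !(memvD, memvZ, memvN) ?Mv ?subM.
Qed.

Import passmx.

Let e := vbasis {:u}.
Let eB : basis_of {:u} e := vbasisP {:u}.

Definition ad_mx X : 'M[R]_(\dim {:u}) := mxof e e (linfun (ad_op L X)).

Lemma ad_mxE X v : rVof e v *m ad_mx X = rVof e (br X v).
Proof. by rewrite /ad_mx -rVof_app // lfunE. Qed.

Lemma vecof_ad_mx X w : vecof e (w *m ad_mx X) = br X (vecof e w).
Proof. by rewrite -[w in LHS](vecofK eB) ad_mxE rVofK. Qed.

Lemma ad_mx_linear : linear ad_mx.
Proof.
move=> a X Y; rewrite /ad_mx.
suff -> : linfun (ad_op L (a *: X + Y)) = a *: linfun (ad_op L X) + linfun (ad_op L Y).
  exact: mxof_linear.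
by apply/lfunP => v; do 3 rewrite ?lfunE /=; rewrite /ad_op (br_linearl L).
Qed.
HB.instance Definition _ := GRing.isLinear.Build _ _ _ _ ad_mx ad_mx_linear.

(** Matrices act on rows from the right, hence the reversed commutator. *)
Lemma ad_mx_br X Y : ad_mx (br X Y) = ad_mx Y *m ad_mx X - ad_mx X *m ad_mx Y.
Proof.
apply/row_matrixP => i; rewrite !rowE; move: (delta_mx 0 i) => w.
apply: (can_inj (vecofK eB)); rewrite mulmxBr linearB /= !mulmxA !vecof_ad_mx.
by rewrite (br_jacobi L X) addrK.
Qed.

Lemma killing_formE X Y : killing_form br X Y = \tr (ad_mx X *m ad_mx Y).
Proof.
rewrite mxtrace_mulC; apply: eq_bigr => i _.
rewrite coord_rVof; change (br X (br Y e`_i)) with (ad_op L X (ad_op L Y e`_i)).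
by rewrite -ad_mxE -ad_mxE rVofE ?(basis_free eB) // -mulmxA -rowE mxE.
Qed.

Lemma killing_form_invariant X Y Z :
  killing_form br (br X Y) Z = killing_form br X (br Y Z).
Proof.
rewrite !killing_formE !ad_mx_br mulmxBl mulmxBr !linearB /=.
by rewrite -mulmxA mxtrace_mulC !mulmxA.
Qed.

Lemma killing_form_linearl a X Y Z :
  killing_form br (a *: X + Y) Z = a * killing_form br X Z + killing_form br Y Z.
Proof. by rewrite !killing_formE linearP mulmxDl -scalemxAl linearP. Qed.

Lemma killing_formC X Y : killing_form br X Y = killing_form br Y X.
Proof. by rewrite !killing_formE mxtrace_mulC. Qed.

(** Write ad [k, y] as a commutator and move ad k to the front by cyclicity: what
    remains is the commutator of ad y with D, which is ad (D y). *)
Lemma trace_ad_derivation k y D : mx_derivation (ad_mx \o vecof e) D ->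
  \tr (ad_mx (br k y) *m D) = - killing_form br k (vecof e (rVof e y *m D)).
Proof.
move=> derD; rewrite killing_formE.
have /= -> := derD (rVof e y); rewrite rVofK // ad_mx_br.
rewrite mulmxBl mulmxBr !(raddfB (@mxtrace R _)) /= opprB; congr (_ - _); last by rewrite mulmxA.
by rewrite mxtrace_mulC mulmxA mxtrace_mulC mulmxA mxtrace_mulC mulmxA.
Qed.

Lemma ad_mx_derivation X : mx_derivation (ad_mx \o vecof e) (ad_mx X).
Proof. by move=> v /=; rewrite vecof_ad_mx ad_mx_br. Qed.

Lemma span_pred (P : u -> Prop) (gs : seq u) : linear_pred P ->
  (forall x, x \in gs -> P x) -> forall x, x \in <<gs>>%VS -> P x.
Proof.
move=> /linear_pred_vspace[W WP] sP x xs; apply/WP.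
by apply: (subvP _ x xs); apply/span_subvP => y /sP /WP.
Qed.

Hypothesis noab : forall I : {vspace u},
  (forall X Y, Y \in I -> br X Y \in I) ->
  (forall X Y, X \in I -> Y \in I -> br X Y = 0) -> I = 0%VS.

(** The radical K is an ideal and the elements of I = [K, u] are ad-nilpotent by
    [trace_ad_derivation].  If I were nonzero, Engel's theorem would give it a
    nonzero centre, an abelian ideal; so K is central, hence zero. *)
Theorem killing_form_nondegenerate Z :
  (forall Y, killing_form br Z Y = 0) -> Z = 0.
Proof.
pose radP X := forall Y, killing_form br X Y = 0.
have [|K KP] := @linear_pred_vspace _ _ radP.
  split=> [Y|a x y Hx Hy Y]; last by rewrite killing_form_linearl Hx Hy mulr0 addr0.
  by rewrite killing_formE linear0 mul0mx linear0.
have Kideal X Y : Y \in K -> br X Y \in K.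
  move=> /KP YK; apply/KP => W.
  by rewrite (br_anti L) -scaleN1r -[_ *: _]addr0 killing_form_linearl
    killing_form_invariant YK mulr0 add0r killing_formE linear0 mul0mx linear0.
pose I := <<[seq br X Y | X <- vbasis K, Y <- e]>>%VS.
have KI X Y : X \in K -> br X Y \in I.
  move=> XK; rewrite (coord_vbasis (memvf Y)).
  change (ad_op L X (\sum_i coord e i Y *: e`_i) \in I).
  rewrite linear_sum rpred_sum // => i _; rewrite linearZ rpredZ //= /ad_op (br_anti L).
  rewrite rpredN (coord_vbasis XK).
  change (ad_op L e`_i (\sum_j coord (vbasis K) j X *: (vbasis K)`_j) \in I).
  rewrite linear_sum rpred_sum // => j _; rewrite linearZ rpredZ //= /ad_op (br_anti L).
  rewrite rpredN memv_span //; apply: allpairs_f; apply: mem_nth; rewrite size_tuple //.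
have IK X : X \in I -> X \in K.
  apply: (subvP _ X); apply/span_subvP => _ /allpairsP[[x y] /= [xK _ ->]].
  by rewrite (br_anti L) rpredN Kideal // vbasis_mem.
have Iideal X Y : Y \in I -> br X Y \in I.
  by move=> YI; rewrite (br_anti L) rpredN; apply: KI; apply: IK.
have Inil X : X \in I -> exists k, forall w, iter k (br X) w = 0.
  move=> XI.
  have [k kP] : exists k, forall v : 'rV_(\dim {:u}), iter k (mulmxr (ad_mx X)) v = 0.
    apply: (nilpotent_derivation_iter (M := ad_mx \o vecof e)).
      exact: ad_mx_derivation.
    move=> D derD; move: X XI; apply: span_pred.
      split=> [|a x y Hx Hy]; first by rewrite linear0 mul0mx linear0.
      by rewrite linearP mulmxDl -scalemxAl linearP /= Hx Hy mulr0 addr0.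
    move=> _ /allpairsP[[x y] /= [xK _ ->]].
    rewrite trace_ad_derivation //; have /KP -> := vbasis_mem xK.
    by rewrite oppr0.
  exists k => w; apply: (can_inj (rVofK eB)); rewrite linear0 -(kP (rVof e w)).
  by elim: (k) => //= j <-; rewrite -ad_mxE.
(* C is the centre of I. *)
have I0 : I = 0%VS.
  have [|C CP] := @linear_pred_vspace _ _
     (fun v => v \in I /\ forall X, X \in I -> br X v = 0).
    split=> [|a x y [xI xC] [yI yC]]; first by split=> [|X _]; rewrite ?mem0v ?br0r.
    by split=> [|X XI]; rewrite ?rpredD ?rpredZ // br_linearr xC ?yC // scaler0 addr0.
  have C0 : C = 0%VS.
    apply: noab => [X Y /CP[YI YC]|X Y /CP[XI _] /CP[_ YC]]; last exact: YC.
    apply/CP; split=> [|W WI]; first exact: Iideal.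
    rewrite (br_jacobi L) (YC W) // br0r addr0 YC // (br_anti L) rpredN.
    exact: Iideal.
  apply/eqP; rewrite -subv0; apply/subvP => x xI; rewrite memv0; apply/eqP.
  apply: contrapT => x0.
  have [|||||w [wI w0 Iw]] := engel (S := I) _ Inil
     (W := fun v => v \in I) (W' := fun v => v = 0).
  - by move=> X Y _; apply: Iideal.
  - by split=> // a y z -> ->; rewrite scaler0 addr0.
  - by move=> X w _; apply: Iideal.
  - by move=> X w _ ->; rewrite br0r.
  - by exists x.
  apply: w0; apply/eqP; rewrite -memv0 -C0; exact/CP.
have K0 : K = 0%VS.
  apply: noab => // X Y XK _.
  by apply/eqP; rewrite -memv0 -I0 KI.
by move=> /KP; rewrite K0 memv0 => /eqP.
Qed.
End LieAlgebra.

Local Open Scope classical_set_scope.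
Local Open Scope ring_scope.

(** * Maps of class C^k *)

Section Ck.
Variable R : realType.
Implicit Types V W Z : normedModType R.

Lemma near0_is_diff V W (h : V -> W) x :
  (\forall y \near x, h y = 0) -> is_diff x h 0.
Proof.
move=> h0.
have E : h \o shift x = cst (h x) + \0 +o_ 0 id.
  apply/eqaddoP => _/posnumP[e].
  move: (h0); rewrite (near_shift 0) subr0 => h0'; near=> y.
  have -> : (h \o shift x - (cst (h x) + \0)) y = 0.
    rewrite /GRing.add /GRing.opp /GRing.zero /= (nbhs_singleton h0) addr0 subr0.
    by near: y.
  by rewrite normr0 mulr_ge0.
have d0 : 'd h x = 0 :> (V -> W) by apply: (diff_unique _ E); exact: cst_continuous.
apply: DiffDef => //; apply/diff_locallyP; rewrite d0; split=> //.
exact: cst_continuous.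
Unshelve. all: by end_near. Qed.

(** Differentials depend on germs only. *)
Lemma near_eq_is_diff V W (f g : V -> W) x : (\forall y \near x, f y = g y) ->
  differentiable f x -> is_diff x g ('d f x).
Proof.
move=> fg df.
have h0 : is_diff x (g - f) 0.
  apply: near0_is_diff; near=> y.
  have fgy : f y = g y by near: y.
  by rewrite -[(g - f) y]/(g y - f y) fgy subrr.
have fx := differentiableP df.
have := is_diffD h0 fx; rewrite subrK add0r //.
Unshelve. all: by end_near. Qed.

Lemma Ck_subset V W k (A B : set V) (f : V -> W) :
  A `<=` B -> Ck_on k B f -> Ck_on k A f.
Proof.
move=> AB; elim: k f => [|k IHk] f /=; first by move=> H x /AB; apply: H.
by move=> [df H]; split=> [x /AB|v]; [exact: df|exact: IHk].
Qed.

(** The set A must be open: [Ck_on] looks at f in whole neighbourhoods of the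
    points of A. *)
Lemma Ck_ext V W k (A : set V) (f g : V -> W) : open A ->
  (forall x, A x -> f x = g x) -> Ck_on k A f -> Ck_on k A g.
Proof.
move=> oA; elim: k f g => [|k IHk] f g fg /=.
  move=> H x Ax; rewrite /prop_for /continuous_at -(fg x Ax).
  apply: cvg_trans (H x Ax); apply: near_eq_cvg; near=> y.
  by apply: fg; near: y; exact: open_nbhs_nbhs.
move=> [df H]; have dfg x : A x -> is_diff x g ('d f x).
  move=> Ax; apply: near_eq_is_diff; last exact: df.
  by near=> y; apply: fg; near: y; exact: open_nbhs_nbhs.
split=> [x Ax|v]; first by have := dfg x Ax => ?; exact: ex_diff.
apply: IHk (H v) => x /dfg dx.
by rewrite diff_val.
Unshelve. all: by end_near. Qed.

Lemma Ck_local V W k (A : set V) (f : V -> W) :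
  (forall x, A x -> exists2 B, B x & Ck_on k B f) -> Ck_on k A f.
Proof.
elim: k f => [|k IHk] f H /=; first by move=> x /H[B Bx]; apply.
split=> [x /H[B Bx [+ _]]|v]; first exact.
by apply: IHk => x /H[B Bx [_ /(_ v)]]; exists B.
Qed.

Lemma CkW V W k (A : set V) (f : V -> W) : Ck_on k.+1 A f -> Ck_on k A f.
Proof.
elim: k f => [|k IHk] f [df H].
  by move=> x /df; exact: differentiable_continuous.
by split=> // v; apply: IHk; apply: H.
Qed.

Lemma Ck_cst V W k (A : set V) (c : W) : Ck_on k A (fun=> c).
Proof.
elim: k c => [|k IHk] c /=; first by move=> x _; exact: cst_continuous.
split=> [x _|v]; first exact: differentiable_cst.
have -> : (fun x => 'd (fun=> c) x v) = (fun=> 0 :> W).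
  by apply/funext => x; rewrite -[fun=> c]/(cst c) diff_cst.
exact: IHk.
Qed.

Lemma CkD V k (A : set V) (f g : V -> R^o) : open A ->
  Ck_on k A f -> Ck_on k A g -> Ck_on k A (fun x => f x + g x).
Proof.
move=> oA; elim: k f g => [|k IHk] f g /=.
  by move=> Hf Hg x Ax; apply: cvgD; [exact: Hf|exact: Hg].
move=> [df Hf] [dg Hg]; split=> [x Ax|v].
  by apply: differentiableD; [exact: df|exact: dg].
apply: (Ck_ext oA _ (IHk _ _ (Hf v) (Hg v))) => x Ax.
by rewrite -[fun x => f x + g x]/(f + g) diffD //; [exact: df|exact: dg].
Qed.

Lemma CkM V k (A : set V) (f g : V -> R^o) : open A ->
  Ck_on k A f -> Ck_on k A g -> Ck_on k A (fun x => (f x * g x : R^o)).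
Proof.
move=> oA; elim: k f g => [|k IHk] f g.
  by move=> Hf Hg x Ax; apply: cvgM; [exact: Hf|exact: Hg].
move=> Hf0 Hg0; case: (Hf0) (Hg0) => [df Hf] [dg Hg]; split=> [x Ax|v].
  by apply: differentiableM; [exact: df|exact: dg].
have Hf1 := CkW Hf0; have Hg1 := CkW Hg0.
apply: (Ck_ext oA _ (CkD oA (IHk _ _ Hf1 (Hg v)) (IHk _ _ Hg1 (Hf v)))) => x Ax.
by rewrite -[fun x => f x * g x]/(f * g) diffM //; [exact: df|exact: dg].
Qed.

(** Precomposition with a map of constant differential l: each derivative of
    [F \o phi] is again a precomposition with phi, so the chain rule needs no
    expansion in coordinates. *)
Lemma Ck_affine V W Z k (A : set V) (B : set W) (phi : V -> W) (l : V -> W)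
    (F : W -> Z) :
  open A -> (forall x, A x -> B (phi x)) -> (forall x, is_diff x phi l) ->
  Ck_on k B F -> Ck_on k A (F \o phi).
Proof.
move=> oA AB dphi; elim: k F => [|k IHk] F /=.
  move=> H x Ax; apply: continuous_comp; last exact/H/AB.
  exact: differentiable_continuous.
move=> [dF H]; split=> [x Ax|v].
  by apply: differentiable_comp => //; exact/dF/AB.
apply: (Ck_ext oA _ (IHk _ (H (l v)))) => x Ax /=.
have dl : 'd phi x = l :> (V -> W) by have := dphi x; case.
have dphix : differentiable phi x by have := dphi x; case.
by rewrite (diff_comp dphix (dF _ (AB _ Ax))) /= dl.
Qed.

Lemma is_diff_coord n (i : 'I_n) (x : 'rV[R]_n) :
  is_diff x (fun N : 'rV[R]_n => N 0 i : R^o) (fun N : 'rV[R]_n => N 0 i : R^o).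
Proof.
have lin : linear (fun N : 'rV[R]_n => N 0 i : R^o) by move=> a v w; rewrite !mxE.
pose m := GRing.isLinear.Build _ _ _ _ _ lin.
pose f : {linear 'rV[R]_n -> R^o} := HB.pack (fun N : 'rV[R]_n => N 0 i : R^o) m.
have fc : continuous f by exact: coord_continuous.
rewrite -[fun N => _]/(f : 'rV[R]_n -> R^o).
by apply: DiffDef; [exact: linear_differentiable|rewrite diff_lin].
Qed.

Lemma Ck_coord V n k (A : set V) (f : V -> 'rV[R]_n) (i : 'I_n) : open A ->
  Ck_on k A f -> Ck_on k A (fun x => (f x 0 i : R^o)).
Proof.
move=> oA; elim: k f => [|k IHk] f.
  move=> H x Ax; apply: (@continuous_comp _ _ _ f (fun N : 'rV[R]_n => N 0 i : R^o)).
    exact: H.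
  exact: coord_continuous.
move=> [df H]; have dc x : A x ->
    is_diff x (fun y => f y 0 i : R^o) (fun v => 'd f x v 0 i : R^o).
  move=> Ax; have fx := differentiableP (df x Ax).
  exact: (is_diff_comp fx (is_diff_coord i (f x))).
split=> [x Ax|v]; first by case: (dc x Ax).
by apply: (Ck_ext oA _ (IHk _ (H v))) => x /dc[_ ->].
Qed.

Lemma Ck_sum V I (r : seq I) k (A : set V) (f : I -> V -> R^o) : open A ->
  (forall i, Ck_on k A (f i)) -> Ck_on k A (fun x => \sum_(i <- r) f i x).
Proof.
move=> oA H; elim: r => [|i r IHr].
  by apply: (Ck_ext oA _ (Ck_cst k A 0)) => x _; rewrite big_nil.
by apply: (Ck_ext oA _ (CkD oA (H i) IHr)) => x _; rewrite big_cons.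
Qed.

(** The derivative of [g \o f] along v is the sum over i of the i-th coordinate of
    ['d f x v] times the i-th partial derivative of g at f x; the induction
    hypothesis applies to these partial derivatives, and C^k functions form an
    algebra. *)
Lemma Ck_comp V n k (A : set V) (B : set 'rV[R]_n) (f : V -> 'rV[R]_n)
    (g : 'rV[R]_n -> R^o) :
  open A -> (forall x, A x -> B (f x)) ->
  Ck_on k A f -> Ck_on k B g -> Ck_on k A (g \o f).
Proof.
move=> oA AB; elim: k g => [|k IHk] g.
  by move=> Hf Hg x Ax; apply: continuous_comp; [exact: Hf|exact/Hg/AB].
move=> Hf0 [dg Hg]; case: (Hf0) => [df Hf]; split=> [x Ax|v].
  by apply: differentiable_comp; [exact: df|exact/dg/AB].
have Hs : Ck_on k A (fun x =>
    \sum_(i < n) (('d f x v 0 i * 'd g (f x) (delta_mx 0 i)) : R^o)).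
  apply: Ck_sum => // i; apply: CkM => //; first exact: (Ck_coord i oA (Hf v)).
  exact: (IHk (fun y => 'd g y (delta_mx 0 i)) (CkW Hf0) (Hg _)).
apply: (Ck_ext oA _ Hs) => x Ax.
rewrite (diff_comp (df x Ax) (dg _ (AB _ Ax))) /=.
rewrite [in RHS](row_sum_delta ('d f x v)) linear_sum /=.
by apply: eq_bigr => i _; rewrite linearZ.
Qed.
End Ck.

(** * Smooth functions on a Lie group *)

Lemma open_preimage_on (T T' : topologicalType) (A : set T) (B : set T')
    (f : T -> T') : open A -> (forall x, A x -> {for x, continuous f}) ->
  open B -> open (A `&` [set x | B (f x)]).
Proof.
move=> oA fc oB; rewrite openE => x [Ax Bfx]; apply: filterI.
  exact: open_nbhs_nbhs.
by apply: (fc x Ax); exact: open_nbhs_nbhs.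
Qed.

Section LieGroup.
Variables (R : realType) (n : nat) (U : lieGroupType R n).
Implicit Types (f : U -> R) (g : U).

Local Notation atlas := (@lie_atlas R n U).

(** The target chart is the identity of the reals, so its conditions are void. *)
Lemma smooth_funP f : smooth_fun f <->
  (continuous (f : U -> R^o) /\
   forall a, atlas a -> forall k, Ck_on k (cimg a) (f \o cinv a : _ -> R^o)).
Proof.
split=> [[fc H]|[fc H]]; split=> // a.
  move=> Aa k; apply: Ck_subset (H a _ Aa (erefl (id_chart R^o)) k).
  by move=> x; split.
move=> b Aa -> k; apply: (@Ck_subset _ _ _ _ _ (cimg a)); first by move=> x [].
exact: H.
Qed.

Lemma chart_atlas a : atlas a -> is_chart a.
Proof. by case: (@lie_atlas_smooth R n U) => + _ _; apply. Qed.

Lemma atlas_cover (x : U) : exists2 a, atlas a & cdom a x.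
Proof. by case: (@lie_atlas_smooth R n U) => _ + _; apply. Qed.

Lemma smooth_fun_linear c f h : smooth_fun f -> smooth_fun h ->
  smooth_fun (fun x => c * f x + h x).
Proof.
move=> /smooth_funP[fc Hf] /smooth_funP[hc Hh]; apply/smooth_funP; split.
  move=> x; apply: cvgD; last exact: hc.
  by apply: cvgM; [exact: cvg_cst|exact: fc].
move=> a Aa k; have [_ oa _ _ _] := chart_atlas Aa.
apply: (CkD oa) (Hh a Aa k); apply: (CkM oa) (Hf a Aa k); exact: Ck_cst.
Qed.

Lemma smooth_funM f h : smooth_fun f -> smooth_fun h ->
  smooth_fun (fun x => f x * h x).
Proof.
move=> /smooth_funP[fc Hf] /smooth_funP[hc Hh]; apply/smooth_funP; split.
  by move=> x; apply: cvgM; [exact: fc|exact: hc].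
move=> a Aa k; have [_ oa _ _ _] := chart_atlas Aa.
exact: (CkM oa (Hf a Aa k) (Hh a Aa k)).
Qed.

(** Near a point, the composite read in a chart a is f read in a chart b around
    the image point, composed with phi read in the charts a and b. *)
Lemma smooth_fun_comp f (phi : U -> U) : smooth_map atlas atlas phi ->
  smooth_fun f -> smooth_fun (f \o phi).
Proof.
move=> [phic phis] /smooth_funP[fc Hf]; apply/smooth_funP; split.
  by move=> x; apply: continuous_comp; [exact: phic|exact: fc].
move=> a Aa k; have [_ oa _ _ [_ ac]] := chart_atlas Aa.
apply: Ck_local => y ay; have [b Ab by_] := atlas_cover (phi (cinv a y)).
have [ob _ bK _ _] := chart_atlas Ab.
pose B := cimg a `&` [set z | cdom b (phi (cinv a z))].
have oB : open B.
  apply: (@open_preimage_on _ _ _ _ (phi \o cinv a)) => // x ax.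
  by apply: continuous_comp; [exact: ac|exact: phic].
exists B => //; pose t z := cmap b (phi (cinv a z)).
have Ct : Ck_on k B ((f \o cinv b : _ -> R^o) \o t).
  apply: (Ck_comp (B := cimg b) oB); last exact: Hf.
    by move=> x [_ /bK[]].
  exact: phis.
by apply: (Ck_ext oB _ Ct) => x [_ /= /bK[_ bx]]; rewrite /t bx.
Qed.

(** In charts, left translation is the multiplication restricted to the affine
    slice with first coordinate that of g. *)
Lemma smooth_mull g : smooth_map atlas atlas (fun x => (g * x)%g).
Proof.
have [mc ms] := @lie_mul_smooth R n U; have [c Ac cg] := atlas_cover g.
have [_ _ cK _ _] := chart_atlas Ac; have [cg1 cg2] := cK g cg.
have phic : continuous (fun x : U => (g * x)%g).
  move=> x; apply: (@continuous_comp _ _ _ (fun x => (g, x)) _ x _ (mc _)).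
  by apply: cvg_pair; [exact: cvg_cst|exact: cvg_id].
split=> // a b Aa Ab k; have [_ oa _ _ [_ ac]] := chart_atlas Aa.
have [ob _ _ _ _] := chart_atlas Ab.
set B := _ `&` _.
have oB : open B.
  apply: (@open_preimage_on _ _ _ _ (fun y => (g * cinv a y)%g)) => // x ax.
  by apply: (@continuous_comp _ _ _ (cinv a)); [exact: ac|exact: phic].
have Acb : prod_atlas atlas atlas (prod_chart c a) by exists c, a.
have H := @Ck_affine R _ _ _ k B _ (fun y => (cmap c g, y)) (fun v => (0, v)) _
   oB _ _ (ms _ b Acb Ab k).
apply: (Ck_ext oB _ (H _ _)).
- by move=> x Bx; rewrite /= cg2.
- by move=> x [ax bx]; split; [split|rewrite /= cg2].
Qed.

End LieGroup.

(** * The Lie algebra, the adjoint action and isotropic orbits *)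

Section LieAlgebraOfGroup.
Variables (R : realType) (n : nat) (U : lieGroupType R n).
Variables (u : vectType R) (d : u -> (U -> R) -> (U -> R)).
Hypothesis dL : lie_algebra_of d.
Implicit Types (f h : U -> R) (g : U) (X Y Z : u).

Lemma smooth_fun_mull g f : smooth_fun f -> smooth_fun (fun x => f (g * x)%g).
Proof. exact: smooth_fun_comp (smooth_mull g). Qed.

(** Right translation is left translation conjugated by inversion. *)
Lemma smooth_fun_mulr g f : smooth_fun f -> smooth_fun (fun x => f (x * g)%g).
Proof.
move=> fs.
have -> : (fun x => f (x * g)%g) = (fun x => f ((g^-1 * x^-1)^-1)%g).
  by apply/funext => x; rewrite invgM !invgK.
have inv := smooth_fun_comp (@lie_inv_smooth R n U).
exact: (inv _ (smooth_fun_mull g^-1%g (inv _ fs))).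
Qed.

Lemma smooth_fun_conj g f : smooth_fun f -> smooth_fun (fun x => f (g * x * g^-1)%g).
Proof. by move=> fs; exact: (smooth_fun_mull g (smooth_fun_mulr g^-1%g fs)). Qed.

Lemma field_smooth X f : smooth_fun f -> smooth_fun (d X f).
Proof. by case: (lie_field dL X) => -[H _ _] _; exact: H. Qed.

Lemma field_linear X (a : R) f h : smooth_fun f -> smooth_fun h ->
  d X (fun x => a * f x + h x) = (fun x => a * d X f x + d X h x).
Proof. by case: (lie_field dL X) => -[_ H _] _; exact: H. Qed.

Lemma field_leibniz X f h : smooth_fun f -> smooth_fun h ->
  d X (fun x => f x * h x) = (fun x => d X f x * h x + f x * d X h x).
Proof. by case: (lie_field dL X) => -[_ _ H] _; exact: H. Qed.

Lemma field_left_invariant X g f : smooth_fun f ->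
  d X (fun x => f (g * x)%g) = (fun x => d X f (g * x)%g).
Proof. by case: (lie_field dL X) => _; exact. Qed.

Lemma smooth_funB f h : smooth_fun f -> smooth_fun h ->
  smooth_fun (fun x => f x - h x).
Proof.
move=> fs hs; have := smooth_fun_linear (-1) hs fs; congr smooth_fun.
by apply/funext => x; ring.
Qed.

Lemma fieldB X f h : smooth_fun f -> smooth_fun h ->
  d X (fun x => f x - h x) = (fun x => d X f x - d X h x).
Proof.
move=> fs hs.
have -> : (fun x => f x - h x) = (fun x => -1 * h x + f x).
  by apply/funext => x; ring.
by rewrite field_linear //; apply/funext => x; ring.
Qed.

(** The commutator of two left-invariant vector fields is a left-invariant vector
    field: the second-order cross terms cancel in the Leibniz rule. *)
Lemma lie_brP X Y f : smooth_fun f ->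
  d (lie_br d X Y) f = (fun x => d X (d Y f) x - d Y (d X f) x).
Proof.
move: f; suff [Z HZ] : exists Z, forall f, smooth_fun f ->
    d Z f = (fun x => d X (d Y f) x - d Y (d X f) x).
  exact: (xgetPex 0 (P := [set Z | forall f, smooth_fun f ->
    d Z f = (fun x => d X (d Y f) x - d Y (d X f) x)])) (ex_intro _ Z HZ).
apply: (lie_surj dL); last first.
  move=> g f fs; rewrite !field_left_invariant //; exact: field_smooth.
have S := field_smooth; split=> [f fs|a f h fs hs|f h fs hs].
- by apply: smooth_funB; apply/S/S.
- rewrite ![d _ (fun x => a * f x + h x)]field_linear // !field_linear //; try exact: S.
  by apply/funext => x; ring.
- rewrite ![d _ (fun x => f x * h x)]field_leibniz //.
  have add A B : smooth_fun A -> smooth_fun B -> forall Z,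
      d Z (fun x => A x + B x) = (fun x => d Z A x + d Z B x).
    move=> As Bs Z.
    have -> : (fun x => A x + B x) = (fun x => 1 * A x + B x).
      by apply/funext => x; rewrite mul1r.
    by rewrite field_linear //; apply/funext => x; rewrite mul1r.
  rewrite !add; try by apply: smooth_funM => //; exact: S.
  rewrite !field_leibniz //; try exact: S.
  by apply/funext => x; ring.
Qed.

Lemma lie_bracket_lie_br : lie_bracket (lie_br d).
Proof.
have S := field_smooth; have I := lie_inj dL.
have dD X Y f : smooth_fun f -> d (X + Y) f = (fun x => d X f x + d Y f x).
  move=> fs; rewrite -[X]scale1r (lie_linear dL) // scale1r.
  by apply/funext => x; rewrite mul1r.
split.
- move=> a X Y Z; apply: I => f fs.
  rewrite (lie_linear dL) // !lie_brP // !(lie_linear dL) //; last exact: S.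
  rewrite field_linear; try exact: S.
  by apply/funext => x; ring.
- move=> X Y; apply: I => f fs.
  rewrite -[- _]addr0 -scaleN1r (lie_linear dL) // -[0 in RHS](subrr X).
  have d0 : d (X - X) f = (fun=> 0).
    apply/funext => x; rewrite -scaleN1r addrC (lie_linear dL) //; ring.
  by rewrite d0 !lie_brP //; apply/funext => x; ring.
- move=> X Y Z; apply: I => f fs.
  rewrite dD // !lie_brP //; try exact: S.
  rewrite !fieldB; try by apply/S/S.
  by apply/funext => x; ring.
Qed.

(** The push-forward under conjugation by g of a left-invariant field is
    left-invariant: translating by c after conjugation amounts to translating by
    [g^-1 * c * g] before it. *)
Lemma AdP g X f : smooth_fun f ->
  d (Ad d g X) f = (fun x : U => d X (fun k => f (g * k * g^-1)%g) (g^-1 * x * g)%g).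
Proof.
move: f; suff [Z HZ] : exists Z, forall f, smooth_fun f ->
    d Z f = (fun x : U => d X (fun k => f (g * k * g^-1)%g) (g^-1 * x * g)%g).
  exact: (xgetPex 0 (P := [set Z | forall f, smooth_fun f ->
    d Z f = (fun x : U => d X (fun k => f (g * k * g^-1)%g) (g^-1 * x * g)%g)]))
    (ex_intro _ Z HZ).
have C := smooth_fun_conj.
apply: (lie_surj dL).
  split=> [f fs|a f h fs hs|f h fs hs].
  - have := C g^-1%g _ (field_smooth X (C g f fs)); congr smooth_fun.
    by apply/funext => x; rewrite invgK.
  - by rewrite field_linear //; exact: C.
  - rewrite field_leibniz; try exact: C.
    apply/funext => x; have -> // : (g * (g^-1 * x * g) * g^-1 = x)%g.
    by rewrite !mulgA mulgV mul1g mulgK.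
move=> c f fs; apply/funext => x.
have := field_left_invariant X (g^-1 * c * g)%g (C g f fs).
move=> /(congr1 (fun F => F (g^-1 * x * g)%g)).
have -> : (g^-1 * c * g * (g^-1 * x * g) = g^-1 * (c * x) * g)%g.
  by rewrite !mulgA mulgK.
move=> <-; congr (d X _ _); apply/funext => k.
by rewrite !mulgA mulgV mul1g.
Qed.

Lemma Ad1 X : Ad d 1%g X = X.
Proof.
apply: (lie_inj dL) => f fs; rewrite AdP //; apply/funext => x.
rewrite invg1 mul1g mulg1; congr (d X _ _).
by apply/funext => k; rewrite mul1g mulg1.
Qed.

Lemma AdM g g1 X : Ad d (g * g1)%g X = Ad d g (Ad d g1 X).
Proof.
apply: (lie_inj dL) => f fs; rewrite !AdP //; last exact: smooth_fun_conj.
apply/funext => x; rewrite invgM !mulgA; congr (d X _ _).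
by apply/funext => k; rewrite !mulgA.
Qed.

Lemma fieldN X f : smooth_fun f -> d (- X) f = (fun x => - d X f x).
Proof.
move=> fs.
have d0 : d (-1 *: X + X) f = (fun x => - d X f x + d X f x).
  by rewrite (lie_linear dL) //; apply/funext => x; rewrite mulN1r.
have d00 : d 0 f = (fun=> 0).
  rewrite -[0](addNr X) -scaleN1r d0.
  by apply/funext => x; rewrite addNr.
rewrite -[- X]addr0 -scaleN1r (lie_linear dL) // d00.
by apply/funext => x; rewrite addr0 mulN1r.
Qed.

Lemma AdN g X : Ad d g (- X) = - Ad d g X.
Proof.
apply: (lie_inj dL) => f fs; rewrite fieldN // !AdP // fieldN //.
exact: smooth_fun_conj.
Qed.

Lemma Ad_orbit_self X : Ad_orbit d X X.
Proof. by exists 1%g => //; exact: Ad1. Qed.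

Lemma Ad_orbit_eq X Y : Ad_orbit d X Y -> Ad_orbit d Y = Ad_orbit d X.
Proof.
move=> [g _ <-]; apply/seteqP; split=> _ [h _ <-].
  by exists (h * g)%g => //; rewrite AdM.
by exists (h * g^-1)%g => //; rewrite -AdM mulgVK.
Qed.

Let LB := lie_bracket_lie_br.

Lemma killingE X Y : killing d X Y = killing_form (lie_br d) X Y.
Proof. by []. Qed.

(** The vectors chosen in the definition of [kks] may differ from X and Y by
    elements commuting with x; invariance of the Killing form absorbs this. *)
Lemma kksE x X Y :
  kks d x (lie_br d X x) (lie_br d Y x) = killing d x (lie_br d X Y).
Proof.
rewrite /kks; set X' := xget _ _; set Y' := xget _ _.
have xX' : lie_br d x X' = lie_br d x X.
  rewrite (br_anti LB) [RHS](br_anti LB); congr (- _).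
  by apply: (xgetPex 0 (P := [set Z | lie_br d Z x = lie_br d X x])); exists X.
have Y'x : lie_br d Y' x = lie_br d Y x.
  by apply: (xgetPex 0 (P := [set Z | lie_br d Z x = lie_br d Y x])); exists Y.
have KI := killing_form_invariant LB; have KC := killing_formC LB.
by rewrite !killingE -!KI xX' KC -KI Y'x KI KC.
Qed.

Hypothesis dS : is_semisimple d.

(** An abelian ideal is solvable after one step, so semisimplicity excludes it. *)
Lemma killing_nondegenerate Z : (forall Y, killing d Z Y = 0) -> Z = 0.
Proof.
apply: (killing_form_nondegenerate LB) => I Iideal Iab; apply: dS => //.
exists 1%N => /=; apply/eqP; rewrite -subv0; apply/span_subvP => v.
by move=> /allpairsP[[x y] /= [xI yI ->]]; rewrite Iab ?mem0v // vbasis_mem.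
Qed.

Lemma centreless Z : (forall X, lie_br d Z X = 0) -> Z = 0.
Proof.
move=> Z0; apply: killing_nondegenerate => Y.
by apply: big1 => i _; rewrite Z0 linear0.
Qed.

(** The form takes the value <x + y, [X, Y]> = <[x + y, X], Y> on the tangent
    vectors at p = (x, y) given by X and Y, so [x + y, X] is orthogonal to
    everything. *)
Lemma isotropic_sum0 p : isotropic_orbit d p -> p.1 + p.2 = 0.
Proof.
move=> iso; apply: centreless => X; apply: killing_nondegenerate => Y.
rewrite killingE (killing_form_invariant LB).
rewrite -[p.1]scale1r (killing_form_linearl LB) mul1r.
have pp : diag_orbit d p p by exists 1%g => //; rewrite !Ad1 -surjective_pairing.
have := iso p pp (lie_br d X p.1, lie_br d X p.2) (lie_br d Y p.1, lie_br d Y p.2).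
by rewrite /prod_kks /= !kksE !killingE; apply; [exists X|exists Y].
Qed.

Lemma isotropic_antidiagonal x : isotropic_orbit d (x, - x).
Proof.
move=> _ [g _ <-] _ _ [X _ <-] [Y _ <-]; rewrite /prod_kks /= !kksE AdN.
set z := Ad d g x.
by rewrite !killingE !(killing_formE LB) linearN mulNmx linearN subrr.
Qed.

End LieAlgebraOfGroup.

Theorem theorem5p2 (R : realType) (n : nat) (U : lieGroupType R n)
    (u : vectType R) (d : u -> (U -> R) -> (U -> R))
    (T : set U) (C : set (u * u)) (H1 H2 : u * u) :
  compact [set: U] ->
  connected [set: U] ->
  lie_algebra_of d ->
  is_semisimple d ->
  is_maximal_torus T ->
  is_weyl_chamber d (lie_of_subgroup d T) C ->
  weyl_chamber_closure d (lie_of_subgroup d T) C H1 ->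
  weyl_chamber_closure d (lie_of_subgroup d T) C H2 ->
  (exists2 p : u * u, (flag d H1 `*` flag d H2) p & isotropic_orbit d p) <->
  flag d H2 = dual_flag d H1.
Proof.
move=> _ _ dL dS _ _ _ _; rewrite /flag /dual_flag; split.
  move=> [[x y] [/= xO yO] /(isotropic_sum0 dL dS) /= /eqP].
  rewrite addrC addr_eq0 => /eqP yE.
  rewrite -(Ad_orbit_eq dL yO) yE; apply: (Ad_orbit_eq dL).
  by case: xO => g _ <-; exists g => //; rewrite (AdN dL).
move=> H12; exists ((cplx_i H1).1, - (cplx_i H1).1).
  by split; rewrite /= ?H12; apply: Ad_orbit_self.
exact: isotropic_antidiagonal.
Qed.
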